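(* Let $G$ be a connected graph of order $n\ge3$ with $m$ edges and Zagreb index $Zg(G)$, and let $\alpha\in[0,1]$ satisfy $\alpha\le1-\frac{n}{2m}$. Then \[E^{A_\alpha}(G)\le\alpha^2Zg(G)+(1-\alpha)^2\|A(G)\|_F^2+\ln\left(\frac{2m(1-\alpha)}{n\Gamma}\right)-\frac{2\alpha m}{n^2}\left(2n\alpha m+2\alpha m-4m+n\right)-\frac{2m}{n^2}(2m-n),\] where $\Gamma=\left|\det\left(A_\alpha(G)-\frac{2\alpha m}{n}I_n\right)\right|$. Equality holds if and only if $G\cong K_n$ and $\alpha=0$, or $G$ is a $k$-regular graph with exactly three distinct $\alpha$-adjacency eigenvalues, given by $k$, $\alpha k+1$ and $\alpha k-1$.
   Context: $G$ is a simple connected graph with vertex degrees $d_1,\dots,d_n$; $A(G)$ its adjacency matrix, $D(G)$ its diagonal degree matrix, $A_\alpha(G)=\alpha D(G)+(1-\alpha)A(G)$ with eigenvalues ($\alpha$-adjacency eigenvalues) $\rho_1\ge\dots\ge\rho_n$, and $E^{A_\alpha}(G)=\sum_{i=1}^n\left|\rho_i-\frac{2\alpha m}{n}\right|$. $Zg(G)=\sum_i d_i^2$; $\|A(G)\|_F^2$ is the squared Frobenius norm of $A(G)$ (equal to $2m$); $I_n$ is the identity matrix; $\ln$ is the natural logarithm; $K_n$ is the complete graph. *)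

(* Defs.v *)
From HB Require Import structures.
From mathcomp Require Export all_boot all_order all_algebra.
From mathcomp Require Export polyrcf.
From mathcomp Require Export all_classical all_reals all_analysis.

Set Implicit Arguments.
Unset Strict Implicit.
Unset Printing Implicit Defensive.

Import Order.TTheory GRing.Theory Num.Theory.
Local Open Scope ring_scope.

(* A simple graph on the vertex set 'I_n is its adjacency relation e, assumed
   symmetric and irreflexive wherever it matters. *)
Section Graph.
Variable n : nat.
Implicit Types (e : rel 'I_n) (k : nat).

Definition connected_graph e : Prop := forall i j, connect e i j.

Definition deg e (i : 'I_n) : nat := #|[set j | e i j]|.

(* Each edge {i, j} is counted once, as the pair (i, j) with i < j. *)
Definition nb_edges e : nat :=
  #|[set p : 'I_n * 'I_n | (p.1 < p.2)%N && e p.1 p.2]|.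

Definition zagreb e : nat := (\sum_i deg e i ^ 2)%N.

Definition regular_graph e k : Prop := forall i, deg e i = k.

Definition complete_graph : rel 'I_n := fun i j => i != j.

Definition graph_iso e1 e2 : Prop :=
  exists2 f : 'I_n -> 'I_n, bijective f & forall i j, e1 i j = e2 (f i) (f j).

End Graph.

Section Matrices.
Variables (R : realType) (n : nat).
Implicit Types (e : rel 'I_n) (M : 'M[R]_n) (alpha : R).

Definition adj_mx e : 'M[R]_n := \matrix_(i, j) (e i j)%:R.

Definition deg_mx e : 'M[R]_n := diag_mx (\row_i (deg e i)%:R).

Definition alpha_mx alpha e : 'M[R]_n :=
  alpha *: deg_mx e + (1 - alpha) *: adj_mx e.

Definition frobenius_sq M : R := \sum_i \sum_j `|M i j| ^+ 2.

(* The real eigenvalues of M, each repeated according to its multiplicity as a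
   root of the characteristic polynomial.  A symmetric M has n of them. *)
Definition spectrum M : seq R :=
  flatten [seq nseq (mup x (char_poly M)) x | x <- rootsR (char_poly M)].

Definition alpha_energy alpha e : R :=
  \sum_(rho <- spectrum (alpha_mx alpha e))
    `|rho - 2 * alpha * (nb_edges e)%:R / n%:R|.

Definition alpha_Gamma alpha e : R :=
  `|\det (alpha_mx alpha e - (2 * alpha * (nb_edges e)%:R / n%:R)%:M)|.

(* The logarithm is extended-real valued: when Gamma = 0 the quotient is +oo,
   hence so are its logarithm and the bound. *)
Definition alpha_energy_bound alpha e : \bar R :=
  let N : R := n%:R in
  let m : R := (nb_edges e)%:R in
  ((alpha ^+ 2 * (zagreb e)%:R
     + (1 - alpha) ^+ 2 * frobenius_sq (adj_mx e))%:E
   + lne ((2 * m * (1 - alpha))%:E / (N * alpha_Gamma alpha e)%:E)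
   - (2 * alpha * m / N ^+ 2
       * (2 * N * alpha * m + 2 * alpha * m - 4 * m + N))%:E
   - (2 * m / N ^+ 2 * (2 * m - N))%:E)%E.

End Matrices.

(* Main.v *)
Require Import Defs.
From mathcomp Require Import complex.
From mathcomp Require Import ring lra zify.

Set Implicit Arguments.
Unset Strict Implicit.
Unset Printing Implicit Defensive.

Import Order.TTheory GRing.Theory Num.Theory.
Local Open Scope ring_scope.

(* Put s_i = |rho_i - c| with c = 2 alpha m / n, and t = 2 m (1 - alpha) / n, which
   is at least 1 by the hypothesis on alpha.  The function f x = x^2 - x - ln x is
   nonnegative, vanishes only at 1 and increases on [1, +oo[.  Summing f (s_i) >= 0
   over all i but the index of the largest eigenvalue, and using f (s_1) >= f t
   there, gives the bound, because the s_i^2 sum to tr (A_alpha - c I)^2 and the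
   product of the s_i is Gamma; s_1 >= t is the Rayleigh bound rho_1 >= 2 m / n at
   the all-ones vector.
   Equality means s_1 = t and s_i = 1 otherwise.  Then the all-ones vector is an
   eigenvector, so G is k-regular, rho_1 = k, and the other eigenvalues, which differ
   from k by connectedness, are alpha k + 1 or alpha k - 1.  As the rho_i - c sum to
   0, alpha k - 1 must occur; if alpha k + 1 does not, then (1 - alpha) k = n - 1,
   which forces alpha = 0 and k = n - 1. *)

(** * Orthogonal diagonalization of real symmetric matrices *)

(** Over [R[i]] the matrix is Hermitian, so the complex spectral theorem applies and its eigenvalues
    are real. The real part of one is a root of [char_poly M], because the embedding of [R] is a
    field morphism. *)
Lemma symmetric_eigenvalue (R : rcfType) n (M : 'M[R]_n.+1) :
  M^T = M -> exists a, eigenvalue M a.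
Proof.
move=> Msym; pose MC := map_mx (real_complex R) M.
have MCherm : MC \is hermsymmx.
  apply: realsym_hermsym.
    by apply/is_hermitianmxP; rewrite expr0 scale1r map_mx_id // /MC
      -[in LHS]Msym map_trmx.
  by apply/mxOverP => i j; rewrite mxE; apply/complex_realP; exists (M i j).
have /hermitian_normalmx /orthomx_spectralP MCE := MCherm.
have /mxOverP/(_ 0 0) := hermitian_spectral_diag_real MCherm.
set a := spectral_diag MC 0 0 => aR.
have Ka : real_complex R (complex.Re a) = a.
  exact: RRe_real.
exists (complex.Re a); rewrite eigenvalue_root_char.
have -> : root (char_poly M) (complex.Re a) = root (char_poly MC) a.
  by rewrite -[in RHS]Ka -map_char_poly fmorph_root.
rewrite -eigenvalue_root_char.
apply/eigenvalueP; exists (row 0 (spectralmx MC)).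
  rewrite -row_mul [X in _ *m X]MCE !mulmxA mulmxV ?spectral_unit // mul1mx.
  by rewrite row_mul row_diag_mx -scalemxAl -rowE.
apply/eqP => r0; have := @row1 R[i] n.+1 0.
rewrite -(mulmxV (spectral_unit MC)) row_mul r0 mul0mx => /rowP/(_ 0)/eqP.
by rewrite !mxE eqxx eq_sym oner_eq0.
Qed.

Lemma dot_sumr (R : pzSemiRingType) n (v w : 'rV[R]_n) :
  (v *m w^T) 0 0 = \sum_i v 0 i * w 0 i.
Proof. by rewrite mxE; apply: eq_bigr => i _; rewrite mxE. Qed.

Lemma dot_ge0 (R : realDomainType) n (v : 'rV[R]_n) : 0 <= (v *m v^T) 0 0.
Proof. by rewrite dot_sumr sumr_ge0 // => i _; rewrite -expr2 sqr_ge0. Qed.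

Lemma dot_eq0 (R : realDomainType) n (v : 'rV[R]_n) :
  ((v *m v^T) 0 0 == 0) = (v == 0).
Proof.
apply/idP/eqP => [|->]; last by rewrite mul0mx mxE.
rewrite dot_sumr psumr_eq0 => [/allP v0|i _]; last by rewrite -expr2 sqr_ge0.
apply/rowP => j; have := v0 j (mem_index_enum j).
by rewrite mulf_eq0 orbb mxE => /eqP.
Qed.

(* Householder: the reflection along [delta_mx 0 0 - v] sends the first basis
   vector to the unit vector v. *)
Lemma orthogonal_first_row (R : rcfType) n (v : 'rV[R]_n.+1) :
  v *m v^T = 1%:M -> exists2 Q : 'M[R]_n.+1, Q *m Q^T = 1%:M & row 0 Q = v.
Proof.
move=> v1; pose e0 : 'rV[R]_n.+1 := delta_mx 0 0.
have [<-|vNe] := eqVneq e0 v.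
  by exists 1%:M; rewrite ?row1 // trmx1 mulmx1.
pose w := e0 - v; pose c := (w *m w^T) 0 0.
have wE : w *m w^T = c%:M by rewrite [LHS]mx11_scalar.
have e01 : e0 *m e0^T = 1%:M.
  rewrite trmx_delta mul_delta_mx.
  by apply/matrixP => i j; rewrite !ord1 !mxE.
(* [e0] and [v] are both unit vectors, so [c] is 2 - 2 (e0 . v). *)
have cE : c = 2 * (e0 *m w^T) 0 0.
  rewrite /c linearB /= mulmxBl !mulmxBr e01 v1.
  have -> : v *m e0^T = (e0 *m v^T)^T by rewrite trmx_mul trmxK.
  by rewrite !mxE eqxx /=; ring.
have c0 : c != 0 by rewrite dot_eq0 subr_eq0.
pose Q : 'M[R]_n.+1 := 1%:M - (2 / c) *: (w^T *m w).
have QT : Q^T = Q by rewrite linearB linearZ /= trmx1 trmx_mul trmxK.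
exists Q.
  rewrite QT /Q mulmxBr mulmx1 mulmxBl mul1mx -scalemxAl -scalemxAr scalerA.
  rewrite -mulmxA (mulmxA w) wE mul_scalar_mx -scalemxAr scalerA.
  have -> : 2 / c * (2 / c) * c = 2 / c + 2 / c by field.
  by rewrite scalerDl opprB addrK subrK.
rewrite rowE -/e0 mulmxBr mulmx1 -scalemxAr mulmxA [e0 *m w^T]mx11_scalar.
rewrite mul_scalar_mx scalerA.
have -> : 2 / c * (e0 *m w^T) 0 0 = 1.
  by rewrite mulrAC -cE divff.
by rewrite scale1r /w opprB addrC subrK.
Qed.

(** The rows of [P] are orthonormal eigenvectors; [d] lists the eigenvalues with multiplicity, in no
    particular order. A commutative ring suffices, so that polynomial entries are allowed. *)
Definition orthodiag (R : comNzRingType) n (M P : 'M[R]_n) (d : 'rV[R]_n) :=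
  P *m P^T = 1%:M /\ M = P^T *m diag_mx d *m P.

(** Deflation: conjugating by an orthogonal matrix whose first row is a unit eigenvector leaves a
    smaller symmetric block, to which induction applies. *)
Lemma real_spectral (R : rcfType) n (M : 'M[R]_n) : M^T = M ->
  exists P d, orthodiag M P d.
Proof.
elim: n M => [|n IHn] M Msym.
  by exists 1%:M, 0; split; apply/matrixP => - [].
have [a /eigenvalueP [v vM v0]] := symmetric_eigenvalue Msym.
pose s := (v *m v^T) 0 0.
have s_gt0 : 0 < s.
  by rewrite lt_def dot_eq0 v0 dot_ge0.
have [|Q QQ rQ] := @orthogonal_first_row R n ((Num.sqrt s)^-1 *: v).
  rewrite linearZ /= -scalemxAl -scalemxAr scalerA [v *m _]mx11_scalar -/s.
  by rewrite scale_scalar_mx -invfM -expr2 sqr_sqrtr ?ltW // mulVf ?gt_eqF.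
have QQ' := mulmx1C QQ.
pose N : 'M[R]_(1 + n) := Q *m M *m Q^T.
have Nsym : N^T = N by rewrite /N !trmx_mul trmxK Msym mulmxA.
have N0 : row 0 N = a *: delta_mx 0 0.
  rewrite !row_mul rQ -scalemxAl vM scalerA mulrC -scalerA -rQ -scalemxAl.
  by rewrite -row_mul QQ row1.
have MN : M = Q^T *m N *m Q by rewrite /N !mulmxA QQ' mul1mx -mulmxA QQ' mulmx1.
clearbody N.
have [P [d [PP Nd]]] := IHn (drsubmx N) (etrans (trmx_drsub _) (congr1 drsubmx Nsym)).
(* The first row of [N] is known from [N0]; symmetry gives the first column. *)
have NE : N = block_mx a%:M 0 0 (drsubmx N).
  have N0j j : N 0 j = a * (j == 0)%:R.
    by move/rowP/(_ j): N0; rewrite !mxE eqxx.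
  have l0 : lshift n (0 : 'I_1) = 0 by apply: val_inj.
  rewrite -[LHS]submxK; congr block_mx; apply/matrixP => i j; rewrite !ord1 !mxE.
  - by rewrite l0 N0j eqxx mulr1.
  - by rewrite l0 N0j mulr0.
  - by rewrite -Nsym mxE l0 N0j mulr0.
pose B : 'M[R]_(1 + n) := block_mx 1%:M 0 0 P.
have BB : B *m B^T = 1%:M.
  rewrite tr_block_mx !trmx0 trmx1 mulmx_block.
  by rewrite !(mulmx0, mul0mx, mulmx1, addr0, add0r) PP -scalar_mx_block.
have BN : B^T *m diag_mx (row_mx (const_mx a) d) *m B = N.
  have da : diag_mx (const_mx a : 'rV[R]_1) = a%:M.
    by apply/matrixP => i j; rewrite !ord1 !mxE.
  rewrite NE Nd diag_mx_row da tr_block_mx !trmx0 trmx1 !mulmx_block.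
  by rewrite !(mulmx0, mul0mx, mulmx1, mul1mx, addr0, add0r).
exists (B *m (Q : 'M[R]_(1 + n))), (row_mx (const_mx a) d : 'rV[R]_(1 + n)); split.
  by rewrite trmx_mul mulmxA -(mulmxA B) QQ mulmx1.
by rewrite MN -BN trmx_mul !mulmxA.
Qed.

(** * Trace, determinant and spectrum of a diagonalized matrix *)

Lemma orthodiag_trace (R : comNzRingType) n (M P : 'M[R]_n) d :
  orthodiag M P d -> \tr M = \sum_i d 0 i.
Proof. by move=> [PP ->]; rewrite mxtrace_mulC mulmxA PP mul1mx mxtrace_diag. Qed.

Lemma orthodiag_sqr (R : comNzRingType) n (M P : 'M[R]_n) d :
  orthodiag M P d -> orthodiag (M *m M) P (\row_i d 0 i ^+ 2).
Proof.
move=> [PP ->]; split=> //.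
rewrite !mulmxA -(mulmxA _ P) PP mulmx1 -(mulmxA P^T) mulmx_diag.
by congr (_ *m diag_mx _ *m _); apply/rowP => i; rewrite !mxE.
Qed.

Lemma orthodiag_shift (R : comNzRingType) n (M P : 'M[R]_n) d c :
  orthodiag M P d -> orthodiag (M - c%:M) P (\row_i (d 0 i - c)).
Proof.
move=> [PP ->]; split=> //.
have -> : diag_mx (\row_i (d 0 i - c)) = diag_mx d - c%:M.
  by apply/matrixP => i j; rewrite !mxE mulrnBl.
by rewrite mulmxBr mulmxBl mul_mx_scalar -scalemxAl (mulmx1C PP) scalemx1.
Qed.

Lemma orthodiag_opp (R : comNzRingType) n (M P : 'M[R]_n) d :
  orthodiag M P d -> orthodiag (- M) P (- d).
Proof. by move=> [PP ->]; split=> //; rewrite linearN mulmxN mulNmx. Qed.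

Lemma orthodiag_det (R : comNzRingType) n (M P : 'M[R]_n) d :
  orthodiag M P d -> \det M = \prod_i d 0 i.
Proof.
move=> [PP ->]; rewrite !det_mulmx det_diag mulrAC -det_mulmx.
by rewrite (mulmx1C PP) det1 mul1r.
Qed.

(** This is the determinant formula for 'X - M, with the diagonalization transported to polynomial
    entries. *)
Lemma orthodiag_char_poly (R : comNzRingType) n (M P : 'M[R]_n) d :
  orthodiag M P d -> char_poly M = \prod_i ('X - (d 0 i)%:P).
Proof.
move=> dM.
have dMX : orthodiag (map_mx polyC M) (map_mx polyC P) (map_mx polyC d).
  case: dM => PP ->; split; first by rewrite map_trmx -map_mxM PP map_mx1.
  by rewrite !map_mxM map_trmx map_diag_mx.
have := orthodiag_det (orthodiag_opp (orthodiag_shift 'X dMX)).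
rewrite opprB /char_poly /char_poly_mx => ->; apply: eq_bigr => i _.
by rewrite !mxE opprB.
Qed.

Lemma orthodiag_eigenvalue (R : fieldType) n (M P : 'M[R]_n) d a :
  orthodiag M P d -> eigenvalue M a <-> exists i, d 0 i = a.
Proof.
move=> dM; rewrite eigenvalue_root_char (orthodiag_char_poly dM).
have -> : \prod_i ('X - (d 0 i)%:P) =
    \prod_(x <- [seq d 0 i | i <- enum 'I_n]) ('X - x%:P).
  by rewrite big_map big_enum.
rewrite root_prod_XsubC; split=> [/mapP[i _ ->]|[i <-]]; first by exists i.
by apply: map_f; rewrite mem_enum.
Qed.

Lemma orthodiag_spectrum (R : realType) n (M P : 'M[R]_n) d :
  orthodiag M P d -> perm_eq (spectrum M) [seq d 0 i | i <- enum 'I_n].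
Proof.
move=> dM; set s := [seq _ | _ <- _].
have pE : char_poly M = \prod_(x <- s) ('X - x%:P).
  by rewrite (orthodiag_char_poly dM) big_map big_enum.
have p0 : char_poly M != 0 by rewrite monic_neq0 // char_poly_monic.
(* Regroup [s] by distinct values: the multiplicity of a root of the product is its number of
   occurrences in [s]. *)
rewrite -[X in perm_eq _ X]/s; apply: perm_trans (perm_count_undup s).
rewrite /spectrum; under eq_map do rewrite pE mu_prod_XsubC.
apply: perm_flatten; apply: perm_map.
apply: uniq_perm; rewrite ?undup_uniq //.
  by apply: sorted_uniq (sorted_roots _ _ _); [apply: lt_trans|apply: ltxx].
move=> x; rewrite mem_undup.
have := roots_on_rootsR p0 x; rewrite in_itv /= => <-.
by rewrite pE root_prod_XsubC.
Qed.

(** * Eigenvectors, quadratic forms and the Rayleigh bound *)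

Lemma orthodiag_row (R : comNzRingType) n (M P : 'M[R]_n) d i :
  orthodiag M P d -> row i P *m M = d 0 i *: row i P.
Proof.
move=> [PP ->]; rewrite -row_mul !mulmxA PP mul1mx row_mul row_diag_mx.
by rewrite -scalemxAl -rowE.
Qed.

Lemma orthodiag_form (R : comNzRingType) n (M P : 'M[R]_n) d (u : 'rV[R]_n) :
  orthodiag M P d ->
  (u *m M *m u^T) 0 0 = \sum_i d 0 i * (u *m P^T) 0 i ^+ 2.
Proof.
move=> [PP ->].
have -> : u *m (P^T *m diag_mx d *m P) *m u^T =
    (u *m P^T *m diag_mx d) *m (u *m P^T)^T.
  by rewrite trmx_mul trmxK !mulmxA.
rewrite dot_sumr; apply: eq_bigr => i _.
by rewrite mul_mx_diag mxE; ring.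
Qed.

Lemma orthodiag_norm (R : comNzRingType) n (M P : 'M[R]_n) d (u : 'rV[R]_n) :
  orthodiag M P d -> (u *m u^T) 0 0 = \sum_i (u *m P^T) 0 i ^+ 2.
Proof.
move=> [PP _]; have -> : u *m u^T = (u *m P^T) *m (u *m P^T)^T.
  by rewrite trmx_mul trmxK mulmxA -(mulmxA u) (mulmx1C PP) mulmx1.
by rewrite dot_sumr; apply: eq_bigr => i _; rewrite expr2.
Qed.

Lemma rayleigh_le (R : realDomainType) n (M P : 'M[R]_n) d (u : 'rV[R]_n) b :
  orthodiag M P d -> (forall i, d 0 i <= b) ->
  (u *m M *m u^T) 0 0 <= b * (u *m u^T) 0 0.
Proof.
move=> dM db; rewrite (orthodiag_form _ dM) (orthodiag_norm _ dM) mulr_sumr.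
by apply: ler_sum => i _; rewrite ler_wpM2r ?sqr_ge0.
Qed.

(** With z the coordinates of [u] in the eigenbasis, the nonnegative terms (b - d_i) z_i^2 sum to 0.
    Hence z_i = 0 wherever d_i differs from [b]. *)
Lemma rayleigh_eq (R : realDomainType) n (M P : 'M[R]_n) d (u : 'rV[R]_n) b :
  orthodiag M P d -> (forall i, d 0 i <= b) ->
  (u *m M *m u^T) 0 0 = b * (u *m u^T) 0 0 -> u *m M = b *: u.
Proof.
move=> dM db; rewrite (orthodiag_form _ dM) (orthodiag_norm _ dM) => /eqP.
rewrite eq_sym mulr_sumr -subr_eq0 -sumrB psumr_eq0 => [/allP z0|i _]; last first.
  by rewrite -mulrBl mulr_ge0 ?sqr_ge0 // subr_ge0.
case: dM => PP ->; set z := u *m P^T in z0.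
have zD : z *m diag_mx d = b *: z.
  apply/rowP => i; rewrite mul_mx_diag mxE [RHS]mxE.
  have := z0 i (mem_index_enum i).
  rewrite -mulrBl mulf_eq0 subr_eq0 sqrf_eq0 => /orP[] /eqP ->; first exact: mulrC.
  by rewrite mul0r mulr0.
by rewrite !mulmxA -/z zD -scalemxAl /z -mulmxA (mulmx1C PP) mulmx1.
Qed.

(** * The logarithmic inequality *)

Lemma ln_le_subr1 (R : realType) (x : R) : 0 < x -> ln x <= x - 1.
Proof.
move=> x0; have := @le_ln1Dx R (x - 1).
by rewrite [1 + _]addrC subrK; apply; rewrite ltrBrDl subrr.
Qed.

Lemma sqrB_ln_leif1 (R : realType) (x : R) : 0 < x ->
  0 <= x ^+ 2 - x - ln x ?= iff (x == 1).
Proof.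
move=> x0; have lnx := ln_le_subr1 x0.
(* Replacing ln x by its upper bound x - 1 leaves exactly this square, which also settles the
   equality case. *)
have sq : (x - 1) ^+ 2 <= x ^+ 2 - x - ln x by lra.
split; first exact: le_trans (sqr_ge0 _) sq.
apply/eqP/eqP => [E|->]; last by rewrite ln1 expr1n !subrr.
apply/eqP; rewrite -subr_eq0 -sqrf_eq0 eq_le sqr_ge0 andbT.
by rewrite E.
Qed.

(** For s > t >= 1, ln (s / t) <= s / t - 1 <= s - t, so the difference is at least (s - t) (s + t -
    2) > 0. *)
Lemma sqrB_ln_leif (R : realType) (t s : R) : 1 <= t -> t <= s ->
  0 <= (s ^+ 2 - s - ln s) - (t ^+ 2 - t - ln t) ?= iff (s == t).
Proof.
move=> t1; rewrite le_eqVlt => /predU1P[->|ts].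
  by rewrite subrr eqxx; apply/leif_refl.
have t0 : 0 < t by lra.
have s0 : 0 < s by lra.
have := ln_le_subr1 (divr_gt0 s0 t0).
rewrite ln_div ?posrE // => lnst.
have stV : s / t <= s - t + 1.
  rewrite ler_pdivrMr //; nra.
suff E : 0 < (s ^+ 2 - s - ln s) - (t ^+ 2 - t - ln t).
  by split; [exact: ltW|rewrite lt_eqF // gt_eqF].
nra.
Qed.

Lemma ln_prod (R : realType) (I : Type) (r : seq I) (s : I -> R) :
  (forall i, 0 < s i) -> ln (\prod_(i <- r) s i) = \sum_(i <- r) ln (s i).
Proof.
move=> s0; elim: r => [|i r IHr]; first by rewrite !big_nil ln1.
by rewrite !big_cons lnM ?IHr // posrE // prodr_gt0.
Qed.

Lemma sum_leif_sqr_ln (R : realType) (I : finType) (s : I -> R) i0 t :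
    (forall i, 0 < s i) -> 1 <= t -> t <= s i0 ->
  \sum_i s i <= \sum_i s i ^+ 2 + ln (t / \prod_i s i) + t - t ^+ 2
    ?= iff (s i0 == t) && [forall (i | i != i0), s i == 1].
Proof.
move=> s0 t1 ts; have t0 : 0 < t by lra.
rewrite ln_div ?posrE ?prodr_gt0 // ln_prod //.
(* Adding the [leif] inequalities carries the equality cases along: the sum vanishes only if every
   term does. *)
have := leifD (sqrB_ln_leif t1 ts)
  (leif_0_sum (fun i (_ : i != i0) => sqrB_ln_leif1 (s0 i))).
have : \sum_i s i ^+ 2 - \sum_i s i - \sum_i ln (s i) =
    s i0 ^+ 2 - s i0 - ln (s i0) +
    \sum_(i | i != i0) (s i ^+ 2 - s i - ln (s i)).
  by rewrite -!sumrB (bigD1 i0).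
set T := \sum_(i | _) _; move=> E; rewrite addr0.
case=> le0 eq0; split; first by lra.
by rewrite -eq0; apply/eqP/eqP; lra.
Qed.

(** * Graphs and their alpha-adjacency matrices *)

Lemma ex_max_entry (R : realDomainType) n (v : 'rV[R]_n) :
  (0 < n)%N -> exists i0, forall i, v 0 i <= v 0 i0.
Proof.
move=> n_gt0; exists [arg max_(j > Ordinal n_gt0) v 0 j]%O.
by case: arg_maxP => // j _ + l; apply.
Qed.

Lemma degE n (e : rel 'I_n) i : deg e i = (\sum_j e i j)%N.
Proof.
rewrite /deg cardsE -sum1_card big_mkcond /=; apply: eq_bigr => j _.
by rewrite unfold_in; case: (e i j).
Qed.

Lemma nb_edgesE n (e : rel 'I_n) :
  nb_edges e = (\sum_(i < n) \sum_(j < n | (i < j)%N) e i j)%N.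
Proof.
rewrite /nb_edges cardsE -sum1_card big_mkcond /=.
rewrite pair_big_dep /= [RHS]big_mkcond; apply: eq_bigr => -[i j] _ /=.
by rewrite unfold_in /=; case: (i < j)%N => //=; case: (e i j).
Qed.

Lemma handshake n (e : rel 'I_n) : symmetric e -> irreflexive e ->
  (\sum_i deg e i = 2 * nb_edges e)%N.
Proof.
move=> e_sym e_irr; rewrite mul2n -addnn {2}nb_edgesE.
(* One copy of the edge count is transposed, to match the entries below the diagonal; the other
   matches those above it. *)
rewrite (exchange_big_dep xpredT) //= nb_edgesE.
rewrite -big_split /=; apply: eq_bigr => i _; rewrite degE.
rewrite (bigID (fun j : 'I_n => (i < j)%N)) /=; congr addn.
rewrite [LHS]big_mkcond [RHS]big_mkcond; apply: eq_bigr => j _ /=.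
rewrite -leqNgt e_sym leq_eqVlt.
by have [/val_inj ->|_] := eqVneq (j : nat) i; rewrite ?e_irr //= ltnn.
Qed.

Lemma deg_le n (e : rel 'I_n) i : irreflexive e -> (deg e i <= n.-1)%N.
Proof.
move=> e_irr; have <- : #|[set~ i]| = n.-1 by rewrite cardsC1 card_ord.
apply: subset_leq_card. apply/fintype.subsetP => j; rewrite !inE.
by apply: contraTneq => ->; rewrite e_irr.
Qed.

Lemma regular_complete n (e : rel 'I_n) : irreflexive e ->
  regular_graph e n.-1 -> e =2 @complete_graph n.
Proof.
move=> e_irr reg i j; rewrite /complete_graph; have [->|ij] := eqVneq i j.
  by rewrite e_irr.
suff /setP/(_ j) : [set j | e i j] = [set~ i] by rewrite !inE eq_sym ij.
apply/eqP; rewrite eqEcard; apply/andP; split.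
  by apply/fintype.subsetP => l; rewrite !inE; apply: contraTneq => ->; rewrite e_irr.
by rewrite cardsC1 card_ord -/(deg e i) reg.
Qed.

Lemma iso_complete n (e : rel 'I_n) :
  graph_iso e (@complete_graph n) -> e =2 @complete_graph n.
Proof.
by move=> [f /bij_inj f_inj ef] i j; rewrite ef /complete_graph (inj_eq f_inj).
Qed.

Lemma complete_regular n (e : rel 'I_n) :
  e =2 @complete_graph n -> regular_graph e n.-1.
Proof.
move=> eK i; rewrite /deg -[in RHS](card_ord n) -(cardsC1 i).
by apply: eq_card => j; rewrite !inE eK /complete_graph eq_sym.
Qed.

Lemma connected_nb_edges n (e : rel 'I_n) : (1 < n)%N ->
  symmetric e -> irreflexive e -> connected_graph e -> (0 < nb_edges e)%N.
Proof.
case: n e => [|[|n]] // e _ e_sym e_irr e_conn.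
have /connectP[[|i p] /= ep] := e_conn ord0 ord_max; first by move/(congr1 val).
move=> _; case/andP: ep => e0i _.
rewrite -(ltn_pmul2l (isT : (0 < 2)%N)) muln0 -handshake // (bigD1 ord0) //= addn_gt0.
by apply/orP; left; apply/card_gt0P; exists i; rewrite inE.
Qed.

(** * Row sums, traces and eigenvectors of [alpha_mx] *)

Section AlphaMatrix.
Variables (R : realType) (n : nat) (e : rel 'I_n) (alpha : R).
Hypotheses (e_sym : symmetric e) (e_irr : irreflexive e).
Let M := alpha_mx alpha e.
Let m : R := (nb_edges e)%:R.

Lemma alpha_mxE i j :
  M i j = alpha * (deg e i)%:R *+ (i == j) + (1 - alpha) * (e i j)%:R.
Proof. by rewrite !mxE; case: eqP; rewrite ?mulr0n ?mulr1n ?mulr0. Qed.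

Lemma alpha_mx_sym : M^T = M.
Proof.
apply/matrixP => i j; rewrite mxE !alpha_mxE e_sym eq_sym.
by case: eqVneq => [->|].
Qed.

Lemma sum_deg : \sum_i (deg e i)%:R = 2 * m.
Proof. by rewrite -natr_sum handshake // natrM. Qed.

Lemma mul_alpha_mxE (v : 'rV[R]_n) i : (v *m M) 0 i =
  alpha * (deg e i)%:R * v 0 i + (1 - alpha) * \sum_(j | e i j) v 0 j.
Proof.
rewrite mxE (bigD1 i) //= alpha_mxE eqxx e_irr mulr0 addr0 mulrC; congr (_ + _).
rewrite mulr_sumr [RHS](big_mkcond (e i)) [LHS]big_mkcond; apply: eq_bigr => j _.
rewrite alpha_mxE e_sym; case: eqVneq => [->|_]; first by rewrite e_irr.
by case: (e i j); rewrite mulr0n add0r ?mulr0 ?mulr1 // mulrC.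
Qed.

(** The weights alpha and 1 - alpha add up to 1, so the row sums do not depend on alpha. *)
Lemma const_mul_alpha_mx : const_mx 1 *m M = \row_i (deg e i)%:R.
Proof.
apply/rowP => i; rewrite mul_alpha_mxE !mxE mulr1.
under eq_bigr do rewrite mxE.
rewrite sumr_const.
have -> : #|e i| = deg e i by rewrite /deg cardsE.
ring.
Qed.

Lemma trace_alpha_mx : \tr M = 2 * alpha * m.
Proof.
rewrite /mxtrace; under eq_bigr do rewrite alpha_mxE eqxx e_irr mulr0 addr0.
by rewrite -mulr_sumr sum_deg mulrCA mulrA.
Qed.

Lemma trace_alpha_mx_sqr : \tr (M *m M) =
  alpha ^+ 2 * (zagreb e)%:R + (1 - alpha) ^+ 2 * frobenius_sq (adj_mx R e).
Proof.
have MT i j : M i j = M j i by rewrite -{1}alpha_mx_sym mxE.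
rewrite /zagreb /frobenius_sq natr_sum !mulr_sumr -big_split /=.
apply: eq_bigr => i _; rewrite mxE mulr_sumr.
(* By symmetry the trace is the sum of the squared entries: the diagonal ones give the Zagreb term,
   the others the Frobenius term. *)
under eq_bigr => j _ do rewrite (MT j i) -expr2 alpha_mxE.
rewrite (bigD1 i) //= [in RHS](bigD1 i) //= !mxE e_irr eqxx.
rewrite !(mulr0, addr0, normr0, expr0n, add0r) /=.
rewrite mulr1n exprMn natrX; congr (_ + _).
apply: eq_bigr => j ji; rewrite eq_sym (negPf ji) mulr0n add0r !mxE exprMn.
by rewrite normr_nat.
Qed.

(** Maximum principle: where [v] is maximal, the eigenvalue equation makes the mean over the
    neighbours equal to the maximum, so every neighbour attains it. Connectedness spreads this to
    all vertices. *)
Lemma regular_eigenvector_const k (v : 'rV[R]_n) :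
  connected_graph e -> regular_graph e k -> alpha < 1 ->
  v *m M = k%:R *: v -> forall i j, v 0 i = v 0 j.
Proof.
move=> e_conn reg a1 vM i j.
have [i0 v_max] := ex_max_entry v (leq_ltn_trans (leq0n i) (ltn_ord i)).
have nbr l l' : v 0 l = v 0 i0 -> e l l' -> v 0 l' = v 0 i0.
  move=> vl ell'; have := mul_alpha_mxE v l; rewrite vM mxE reg => E.
  have : \sum_(p | e l p) (v 0 i0 - v 0 p) = 0.
    rewrite sumrB sumr_const.
    have -> : #|e l| = k by rewrite -(reg l) /deg cardsE.
    have : (1 - alpha) * (v 0 i0 *+ k - \sum_(p | e l p) v 0 p) = 0.
      rewrite -vl -mulr_natr; lra.
    move/eqP; rewrite mulf_eq0 subr_eq0 => /orP[/eqP|/eqP //]; lra.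
  move/eqP; rewrite psumr_eq0 => [/allP/(_ l' (mem_index_enum _))|p _].
    by rewrite ell' subr_eq0 => /eqP.
  by rewrite subr_ge0.
suff vE l : v 0 l = v 0 i0 by rewrite !vE.
have /connectP[p] := e_conn i0 l.
elim/last_ind: p l => [|p x IHp] l /=; first by move=> _ ->.
rewrite rcons_path last_rcons => /andP[pp ex] ->.
by apply: nbr ex; apply: IHp.
Qed.

End AlphaMatrix.

(** * The energy bound *)

Section Bound.
Variables (R : realType) (n : nat) (e : rel 'I_n) (alpha : R).
Hypotheses (n_ge3 : (3 <= n)%N) (e_sym : symmetric e) (e_irr : irreflexive e)
  (e_conn : connected_graph e)
  (alpha_le : alpha <= 1 - n%:R / (2 * (nb_edges e)%:R)).
Let M := alpha_mx alpha e.
Let m : R := (nb_edges e)%:R.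
Let N : R := n%:R.
(** [c] is the mean of the eigenvalues, and [c + t] is the mean degree. *)
Let c := 2 * alpha * m / N.
Let t := 2 * m * (1 - alpha) / N.
Let u : 'rV[R]_n := const_mx 1.

Lemma natr_order_gt0 : 0 < N.
Proof. by rewrite ltr0n (leq_trans _ n_ge3). Qed.

Lemma natr_nb_edges_gt0 : 0 < m.
Proof. by rewrite ltr0n (connected_nb_edges (ltnW n_ge3)). Qed.

Lemma mean_degree_gap_ge1 : 1 <= t.
Proof.
have N0 := natr_order_gt0; have m0 := natr_nb_edges_gt0.
have : N / (2 * m) <= 1 - alpha by move: alpha_le; rewrite -/m -/N; lra.
rewrite ler_pdivrMr ?mulr_gt0 // => h.
by rewrite /t ler_pdivlMr // mul1r; lra.
Qed.

Lemma alpha_lt1 : alpha < 1.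
Proof.
have : 0 < N / (2 * m) by rewrite divr_gt0 ?mulr_gt0 ?natr_order_gt0 ?natr_nb_edges_gt0.
by move: alpha_le; rewrite -/m -/N; lra.
Qed.

Lemma alpha_energy_bound_singular :
  alpha_Gamma alpha e = 0 -> alpha_energy_bound alpha e = +oo%E.
Proof.
move=> G0; rewrite /alpha_energy_bound G0 mulr0 inve0 gt0_muley //.
by rewrite lte_fin !mulr_gt0 ?natr_nb_edges_gt0 // subr_gt0 alpha_lt1.
Qed.

(** Brings the bound to the shape of [sum_leif_sqr_ln]: the last two terms of the definition amount
    to - n c^2 + t - t^2. *)
Lemma alpha_energy_bound_nonsingular : alpha_Gamma alpha e != 0 ->
  alpha_energy_bound alpha e =
  (\tr (M *m M) - 4 * alpha ^+ 2 * m ^+ 2 / N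
   + ln (t / alpha_Gamma alpha e) + t - t ^+ 2)%:E.
Proof.
move=> G0; have N0 := natr_order_gt0; have m0 := natr_nb_edges_gt0; have a1 := alpha_lt1.
have G_gt0 : 0 < alpha_Gamma alpha e by rewrite lt_def G0 normr_ge0.
rewrite /alpha_energy_bound -/m -/N inver gt_eqF ?mulr_gt0 // -EFinM lne_EFin; last first.
  by rewrite !(divr_gt0, mulr_gt0) // subr_gt0.
have EFinDBB (x y z w : R) : (x%:E + y%:E - z%:E - w%:E = (x + y - z - w)%:E)%E.
  by [].
rewrite EFinDBB; congr (_%:E).
rewrite trace_alpha_mx_sqr //.
have -> : 2 * m * (1 - alpha) / (N * alpha_Gamma alpha e) = t / alpha_Gamma alpha e.
  by rewrite /t invfM mulrA.
by rewrite /t; field; rewrite gt_eqF.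
Qed.

Lemma regular_nb_edges k : regular_graph e k -> 2 * m = N * k%:R.
Proof.
move=> reg; rewrite /m -sum_deg //; under eq_bigr do rewrite reg.
by rewrite sumr_const card_ord mulrC mulr_natr.
Qed.

Lemma const_mx_alpha_form :
  (u *m M *m u^T) 0 0 = 2 * m.
Proof.
rewrite const_mul_alpha_mx // dot_sumr -sum_deg //.
by apply: eq_bigr => i _; rewrite !mxE mulr1.
Qed.

Lemma const_mx_dot : (u *m u^T) 0 0 = N.
Proof.
rewrite dot_sumr; under eq_bigr do rewrite !mxE mulr1.
by rewrite sumr_const card_ord.
Qed.

Section Diagonalized.
Variables (P : 'M[R]_n) (d : 'rV[R]_n).
Hypothesis dM : orthodiag M P d.

Lemma alpha_energy_sum : alpha_energy alpha e = \sum_i `|d 0 i - c|.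
Proof.
by rewrite /alpha_energy (perm_big _ (orthodiag_spectrum dM)) big_map big_enum.
Qed.

Lemma alpha_Gamma_prod : alpha_Gamma alpha e = \prod_i `|d 0 i - c|.
Proof.
rewrite /alpha_Gamma (orthodiag_det (orthodiag_shift _ dM)) normr_prod.
by apply: eq_bigr => i _; rewrite mxE.
Qed.

Lemma sum_eigenvalue_shift : \sum_i (d 0 i - c) = 0.
Proof.
rewrite sumrB -(orthodiag_trace dM) trace_alpha_mx // sumr_const card_ord.
rewrite -mulr_natr /c; field.
by rewrite gt_eqF // natr_order_gt0.
Qed.

Lemma sum_eigenvalue_shift_sqr : \sum_i `|d 0 i - c| ^+ 2 =
  \tr (M *m M) - 4 * alpha ^+ 2 * m ^+ 2 / N.
Proof.
have N0 := natr_order_gt0.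
rewrite (orthodiag_trace (orthodiag_sqr dM)).
under eq_bigr do rewrite real_normK ?num_real // sqrrB.
rewrite big_split sumrB /= sumr_const card_ord -mulr_natr.
under [in RHS]eq_bigr do rewrite mxE.
have := orthodiag_trace dM; rewrite trace_alpha_mx // => E.
rewrite sumrMnl -mulr_suml -E -/m -/N /c; field.
by rewrite gt_eqF.
Qed.

Lemma mean_degree_le_max_eigenvalue i0 : (forall i, d 0 i <= d 0 i0) -> c + t <= d 0 i0.
Proof.
have N0 := natr_order_gt0.
move=> /(rayleigh_le u dM); rewrite const_mx_alpha_form const_mx_dot => h.
have -> : c + t = 2 * m / N by rewrite /c /t; field; rewrite gt_eqF.
by rewrite ler_pdivrMr.
Qed.

(** Equality in the Rayleigh bound makes the all-ones vector an eigenvector, so the row sums, which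
    are the degrees, are all equal. *)
Lemma max_eigenvalue_regular i0 : (forall i, d 0 i <= d 0 i0) -> d 0 i0 = c + t ->
  exists2 k, regular_graph e k & d 0 i0 = k%:R.
Proof.
have N0 := natr_order_gt0.
move=> imax di0; have : u *m M = d 0 i0 *: u.
  apply: rayleigh_eq dM imax _; rewrite const_mx_alpha_form const_mx_dot di0 /c /t.
  by field; rewrite gt_eqF.
rewrite const_mul_alpha_mx // => /rowP degE.
have degi i : (deg e i)%:R = d 0 i0 by have := degE i; rewrite !mxE mulr1.
exists (deg e i0); last by rewrite degi.
by move=> i; apply/eqP; rewrite -(eqr_nat R) !degi.
Qed.

(** Two different rows of [P] for the eigenvalue k would both be constant, hence parallel, yet
    orthonormal. *)
Lemma regular_eigenvalue_simple k i j :
  regular_graph e k -> d 0 i = k%:R -> d 0 j = k%:R -> i = j.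
Proof.
move=> reg di dj; apply/eqP/negPn/negP => ij.
have ci l l' : P i l = P i l'.
  have := regular_eigenvector_const e_sym e_irr e_conn reg alpha_lt1.
  move=> /(_ (row i P)); rewrite (orthodiag_row i dM) di => /(_ erefl l l').
  by rewrite !mxE.
have cj l l' : P j l = P j l'.
  have := regular_eigenvector_const e_sym e_irr e_conn reg alpha_lt1.
  move=> /(_ (row j P)); rewrite (orthodiag_row j dM) dj => /(_ erefl l l').
  by rewrite !mxE.
have [PP _] := dM.
have PPE a b : (P *m P^T) a b = \sum_l P a l * P b l.
  by rewrite mxE; apply: eq_bigr => l _; rewrite mxE.
have := PPE i j; have := PPE i i; have := PPE j j; rewrite PP !mxE !eqxx (negPf ij).
under eq_bigr do rewrite (cj _ i).
under [in X in _ -> X -> _]eq_bigr do rewrite (ci _ i).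
under [in X in _ -> _ -> X -> _]eq_bigr do rewrite (ci _ i) (cj _ i).
have sumN (x : R) : \sum_(l < n) x = x * N.
  by rewrite sumr_const card_ord mulr_natr.
rewrite !sumN => h1 h2 h3.
have : 1 = (P j i * P j i * N) * (P i i * P i i * N) by rewrite -h1 -h2 mulr1.
have -> : (P j i * P j i * N) * (P i i * P i i * N) = (P i i * P j i * N) ^+ 2 by ring.
by rewrite -h3 mulr0n expr0n /= => /eqP; rewrite oner_eq0.
Qed.

(** The equality case only confines the eigenvalues to three values; which of them occur is decided
    in the theorem. *)
Lemma alpha_energy_le_bound :
  ((alpha_energy alpha e)%:E <= alpha_energy_bound alpha e)%E /\
  ((alpha_energy alpha e)%:E = alpha_energy_bound alpha e <->
   exists2 k, regular_graph e k &
     forall i, d 0 i \in [:: k%:R; alpha * k%:R + 1; alpha * k%:R - 1]).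
Proof.
have [i0 imax] := ex_max_entry d (ltnW (ltnW n_ge3)); have t1 := mean_degree_gap_ge1.
have dt := mean_degree_le_max_eigenvalue imax.
have tle : t <= `|d 0 i0 - c| by apply: le_trans (ler_norm _); lra.
have ck k : regular_graph e k -> c = alpha * k%:R /\ t = (1 - alpha) * k%:R.
  move=> reg; have N0 := natr_order_gt0; rewrite /c /t.
  have -> : 2 * alpha * m = alpha * (2 * m) by ring.
  by rewrite (regular_nb_edges reg); split; field; rewrite gt_eqF.
have suffC : (exists2 k, regular_graph e k &
     forall i, d 0 i \in [:: k%:R; alpha * k%:R + 1; alpha * k%:R - 1]) <->
  `|d 0 i0 - c| = t /\ forall i, i != i0 -> `|d 0 i - c| = 1.
  split=> [[k reg dk]|[di0 di]].
    have [ckE tk] := ck k reg.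
    have di0 : d 0 i0 = k%:R.
      (* Here c + t = k is at most [d 0 i0], and t = (1 - alpha) k >= 1 keeps the other two values
         from exceeding k. *)
      by move: (dk i0); rewrite !inE => /or3P[] /eqP E //; lra.
    split; first by rewrite di0 ger0_norm; lra.
    move=> i ii0; move: (dk i); rewrite !inE => /or3P[] /eqP E.
    - by rewrite (regular_eigenvalue_simple reg E di0) eqxx in ii0.
    - by rewrite E ckE addrAC subrr add0r normr1.
    - by rewrite E ckE addrAC subrr add0r normrN1.
  have di0E : d 0 i0 = c + t by move: di0; rewrite ger0_norm; lra.
  have [k reg dk] := max_eigenvalue_regular imax di0E.
  exists k => // i; have [ckE tk] := ck k reg.
  have [->|ii0] := eqVneq i i0; first by rewrite dk mem_head.
  have /eqP := di i ii0; rewrite eqr_norml ler01 andbT -ckE !inE.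
  by rewrite !subr_eq ![_ + c]addrC => /orP[] ->; rewrite !orbT.
have [G0|G0] := eqVneq (alpha_Gamma alpha e) 0.
  (* The bound is infinite, so equality fails; the right-hand side fails too, since it makes every
     factor of Gamma equal to t or 1. *)
  rewrite alpha_energy_bound_singular // leey; split=> //; split=> // /suffC[di0 di].
  move: G0; rewrite alpha_Gamma_prod => /eqP; rewrite prodf_seq_eq0 => /hasP[i _] /=.
  have [->|ii0] := eqVneq i i0; first by rewrite di0 gt_eqF //; lra.
  by rewrite di // oner_eq0.
have s0 i : 0 < `|d 0 i - c|.
  rewrite lt_def normr_ge0 andbT; apply: contra G0 => si.
  by rewrite alpha_Gamma_prod prodf_seq_eq0; apply/hasP; exists i;
    rewrite ?mem_index_enum.
have := sum_leif_sqr_ln s0 t1 tle.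
rewrite alpha_energy_bound_nonsingular // -alpha_energy_sum -alpha_Gamma_prod.
rewrite sum_eigenvalue_shift_sqr => -[le eq].
rewrite lee_fin le; split=> //; rewrite suffC; split.
  case=> /eqP; rewrite eq => /andP[/eqP -> /forall_inP di]; split=> // i ii0.
  exact/eqP/di.
move=> [di0 di]; congr _%:E; apply/eqP; rewrite eq di0 eqxx.
by apply/forall_inP => i ii0; rewrite di.
Qed.

End Diagonalized.
End Bound.

(** * The complete graph and the equality cases *)

Lemma complete_eigenvalue (R : realType) n (e : rel 'I_n) (a : R) :
  (0 < n)%N -> e =2 @complete_graph n -> eigenvalue (alpha_mx 0 e) a ->
  a = n.-1%:R \/ a = - 1.
Proof.
move=> n_gt0 eK /eigenvalueP[v vM v0].
have e_sym : symmetric e by move=> i j; rewrite !eK /complete_graph eq_sym.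
have e_irr : irreflexive e by move=> i; rewrite eK /complete_graph eqxx.
pose S := \sum_j v 0 j.
(* Summing this over i gives (a + 1) S = n S: either a = n - 1, or S = 0 and then a = -1. *)
have vS i : (a + 1) * v 0 i = S.
  have := mul_alpha_mxE 0 e_sym e_irr v i.
  rewrite vM mxE !mul0r add0r subr0 mul1r mulrDl mul1r => ->.
  rewrite addrC /S [RHS](bigD1 i) //=; congr (_ + _).
  by apply: eq_bigl => j; rewrite eK /complete_graph eq_sym.
have aS : (a + 1) * S = n%:R * S.
  rewrite [in LHS]/S mulr_sumr; under eq_bigr do rewrite vS.
  by rewrite sumr_const card_ord mulr_natl.
have [S0|S0] := eqVneq S 0; last first.
  have nE : n%:R = n.-1%:R + 1 :> R by rewrite natr1 prednK.
  by left; move/(mulIf S0): aS; rewrite nE => /addIr.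
right; apply/eqP; rewrite -addr_eq0; apply: contraNT v0 => a1.
apply/eqP/rowP => i; have /eqP := vS i.
by rewrite S0 mulf_eq0 (negPf a1) mxE => /eqP.
Qed.

Theorem theorem2p14 (R : realType) (n : nat) (e : rel 'I_n) (alpha : R)
    (n_ge3 : (3 <= n)%N)
    (e_sym : symmetric e) (e_irr : irreflexive e) (e_conn : connected_graph e)
    (alpha01 : 0 <= alpha <= 1)
    (alpha_le : alpha <= 1 - n%:R / (2 * (nb_edges e)%:R)) :
  ((alpha_energy alpha e)%:E <= alpha_energy_bound alpha e)%E
  /\ ((alpha_energy alpha e)%:E = alpha_energy_bound alpha e <->
      (graph_iso e (@complete_graph n) /\ alpha = 0)
      \/ exists k : nat,
          [/\ regular_graph e k,
              uniq [:: k%:R; alpha * k%:R + 1; alpha * k%:R - 1]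
            & forall a : R, eigenvalue (alpha_mx alpha e) a
                <-> a \in [:: k%:R; alpha * k%:R + 1; alpha * k%:R - 1]]).
Proof.
have [alpha_ge0 _] := andP alpha01.
have [P [d dM]] := real_spectral (alpha_mx_sym alpha e_sym).
have [le ->] := alpha_energy_le_bound n_ge3 e_sym e_irr e_conn alpha_le dM.
split=> //; have dP a := orthodiag_eigenvalue a dM.
(* The two sufficient conditions come first; the case split on a regular graph follows. *)
split=> [[k reg dk]|[[iso a0]|[k [reg _ ak]]]]; last 2 first.
- have eK := iso_complete iso; exists n.-1; first exact: complete_regular.
  move=> i; rewrite a0 mul0r add0r sub0r !inE.
  have : eigenvalue (alpha_mx alpha e) (d 0 i) by apply/dP; exists i.
  rewrite a0 => /(complete_eigenvalue _ eK)[|->|->]; first by lia.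
    by rewrite eqxx.
  by rewrite eqxx !orbT.
- by exists k => // i; apply/ak/dP; exists i.
have a1 : alpha < 1 by apply: (@alpha_lt1 R n e alpha).
have n_gt0 : 0 < n%:R :> R by rewrite ltr0n; lia.
have nE : n%:R = n.-1%:R + 1 :> R by rewrite natr1 prednK //; lia.
have n1_ge2 : 2 <= n.-1%:R :> R by rewrite ler_nat; lia.
have k_le : k%:R <= n.-1%:R :> R.
  have i : 'I_n by exists 0%N; lia.
  by rewrite ler_nat -(reg i) deg_le.
have cE : 2 * alpha * (nb_edges e)%:R / n%:R = alpha * k%:R.
  have := regular_nb_edges R e_sym e_irr reg => mk.
  have -> : 2 * alpha * (nb_edges e)%:R = alpha * (2 * (nb_edges e)%:R) by ring.
  by rewrite mk; field; rewrite gt_eqF.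
have k_eigen : eigenvalue (alpha_mx alpha e) k%:R.
  apply/eigenvalueP; exists (const_mx 1).
    by rewrite const_mul_alpha_mx //; apply/rowP => i; rewrite !mxE reg mulr1.
  apply/eqP => /rowP/(_ (Ordinal (ltnW (ltnW n_ge3))))/eqP.
  by rewrite !mxE oner_eq0.
have [i0 di0] := (dP _).1 k_eigen.
have dNk i : i != i0 -> d 0 i != k%:R.
  apply: contraNneq => di; apply/eqP.
  exact: (regular_eigenvalue_simple n_ge3 e_sym e_irr e_conn alpha_le dM reg di di0).
have sum0 := sum_eigenvalue_shift n_ge3 e_sym e_irr dM.
rewrite (bigD1 i0) //= di0 cE in sum0.
(* If the n - 1 other eigenvalues coincide, the vanishing sum of the shifted eigenvalues determines
   (1 - alpha) k. *)
have sum_const x : (forall i, i != i0 -> d 0 i = alpha * k%:R + x) ->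
    (1 - alpha) * k%:R + n.-1%:R * x = 0.
  move=> dx; rewrite -[RHS]sum0 mulrBl mul1r; congr (_ + _).
  under [RHS]eq_bigr => i ii0 do rewrite dx // addrAC subrr add0r.
  by rewrite sumr_const cardC1 card_ord mulr_natl.
have [|/existsPn N1] :=
  boolP [exists i, (i != i0) && (d 0 i == alpha * k%:R + 1)]; last first.
  (* Without alpha k + 1, (1 - alpha) k = n - 1; as k <= n - 1, this forces alpha k = 0. *)
  have E : (1 - alpha) * k%:R + n.-1%:R * -1 = 0.
    apply: sum_const => i ii0; have := N1 i; have := dk i.
    rewrite ii0 /= !inE (negPf (dNk i ii0)) /=.
    by case/orP=> /eqP -> //; rewrite eqxx.
  have k_ge0 : 0 <= k%:R :> R by rewrite ler0n.
  have ak_ge0 : 0 <= alpha * k%:R by rewrite mulr_ge0.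
  have ak0 : alpha * k%:R = 0 by lra.
  have k0 : 0 < k%:R :> R by lra.
  have alpha0 : alpha = 0.
    by move/eqP: ak0; rewrite mulf_eq0 [k%:R == 0]gt_eqF // orbF => /eqP.
  left; split=> //; exists id; first by exists id.
  apply: regular_complete => // i; rewrite reg; apply/eqP.
  by rewrite -(eqr_nat R); apply/eqP; move: E; rewrite alpha0; lra.
have [|/existsPn N2 _] :=
  boolP [exists i, (i != i0) && (d 0 i == alpha * k%:R - 1)]; last first.
  (* Without alpha k - 1, a nonnegative and a positive number would sum to 0. *)
  have E : (1 - alpha) * k%:R + n.-1%:R * 1 = 0.
    apply: sum_const => i ii0; have := N2 i; have := dk i.
    rewrite ii0 /= !inE (negPf (dNk i ii0)) /=.
    by case/orP=> /eqP -> //; rewrite eqxx.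
  have : 0 <= (1 - alpha) * k%:R by rewrite mulr_ge0 // subr_ge0 ltW.
  lra.
move=> /existsP[i2 /andP[_ /eqP di2]] /existsP[i1 /andP[i1i0 /eqP di1]].
have t1 := mean_degree_gap_ge1 n_ge3 e_sym e_irr e_conn alpha_le.
have tk : 1 <= (1 - alpha) * k%:R.
  have -> : (1 - alpha) * k%:R = 2 * (nb_edges e)%:R * (1 - alpha) / n%:R.
    by rewrite (regular_nb_edges R e_sym e_irr reg); field; rewrite gt_eqF.
  exact: t1.
right; exists k; split=> //.
  rewrite /= !inE negb_or !andbT; apply/andP; split; last by apply/eqP; lra.
  apply/andP; split; last by apply/eqP; lra.
  (* k and alpha k + 1 differ because k is a simple eigenvalue and [i1] is not [i0]; the inequality
     [tk] alone would allow them to coincide. *)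
  by rewrite eq_sym -di1; apply: dNk.
move=> a; rewrite dP; split=> [[i <-]|]; first exact: dk.
by rewrite !inE => /or3P[] /eqP ->; [exists i0|exists i1|exists i2].
Qed.
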